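(* For every set $\Gamma$ of formulas of $\mathcal{L}_{\mathsf{MBCL}}$ and every formula $A$: if $\Gamma\vdash_{Ax_{\mathsf{MBCL}}^{\mathsf{CUDL}}}A$, then $\Gamma\vDash_{\mathbf{F}^{dL}}A$.
   Context: $\mathcal{L}_{\mathsf{MBCL}}$ has variables $p_0,p_1,\dots$ (set $\mathrm{Var}$), unary $\neg,\Box,\Diamond$, binary $\wedge,\vee,\rightarrow$; $\mathrm{For}$ its formulas. $A\supset B:=\neg A\vee B$, $A\equiv B:=(\neg A\vee B)\wedge(\neg B\vee A)$. The demodalization $d:\mathrm{For}\to\mathrm{For}$ is defined by $d(p)=p$ for variables, $d(\neg A)=\neg d(A)$, $d(A\star B)=d(A)\star d(B)$ for $\star\in\{\wedge,\vee,\rightarrow\}$, $d(\Box A)=d(\Diamond A)=d(A)$. A model is $\langle W,Q,\{R_w\}_{w\in W},v\rangle$ with $W\neq\emptyset$, $Q\subseteq W\times W$, $R_w\subseteq\mathrm{For}\times\mathrm{For}$, $v:W\times\mathrm{Var}\to\{0,1\}$; $\langle W,Q,\{R_w\}\rangle$ is its frame. Truth at $w$: $p$ iff $v(w,p)=1$; $\neg,\wedge,\vee$ classical; $\Box B$ iff $B$ true at every $Q$-successor of $w$; $\Diamond B$ iff $B$ true at some $Q$-successor; $B\rightarrow C$ iff ($B$ false at $w$ or $C$ true at $w$) and $R_w(B,C)$. Conditions on a relation $R$ (for all $A,B$): (a1) not $R(A,\neg A)$; (a2) not $R(\neg A,A)$; (b0) $R(A,B)\Rightarrow$ not $R(A,\neg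 B)$; (b1) $R(A\rightarrow B,\neg(A\rightarrow\neg B))$; (b2) $R(A\rightarrow\neg B,\neg(A\rightarrow B))$; (demL) $R(d(A),d(B))\Rightarrow R(A,B)$. $\mathbf{F}^{dL}$: frames in which every $R_w$ satisfies (a1),(a2),(b0),(b1),(b2),(demL). $\Gamma\vDash_{\mathbf{F}^{dL}}A$: for every model on a frame in the class and every world $w$, if all of $\Gamma$ true at $w$ then $A$ true at $w$. $Ax_{\mathsf{MBCL}}^{\mathsf{CUDL}}$ has axiom schemata: (CPL) substitution instances of classical tautologies; $\neg(A\rightarrow\neg A)$; $\neg(\neg A\rightarrow A)$; $(A\rightarrow B)\rightarrow\neg(A\rightarrow\neg B)$; $(A\rightarrow\neg B)\rightarrow\neg(A\rightarrow B)$; $(A\rightarrow B)\supset(A\supset B)$; (Dual) $\Diamond A\equiv\neg\Box\neg A$; (K$^\supset$) $\Box(A\supset B)\supset(\Box A\supset\Box B)$; (CUDL) $(d(A)\rightarrow d(B))\supset((A\rightarrow B)\vee(A\wedge\neg B))$; rules: from $A$ and $A\supset B$ infer $B$; from a theorem $A$ infer $\Box A$. $\Gamma\vdash A$: $A$ derivable from theorems and members of $\Gamma$ using the first rule. *)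

(* Defs.v *)
Inductive form : Type :=
| Var (n : nat)
| Neg (A : form)
| Box (A : form)
| Dia (A : form)
| And (A B : form)
| Or  (A B : form)
| Arr (A B : form).

Declare Scope mbcl_scope.
Delimit Scope mbcl_scope with mbcl.
Bind Scope mbcl_scope with form.

Notation "¬ A" := (Neg A) (at level 35, right associativity) : mbcl_scope.
Notation "□ A" := (Box A) (at level 35, right associativity) : mbcl_scope.
Notation "◇ A" := (Dia A) (at level 35, right associativity) : mbcl_scope.
Notation "A ∧ B" := (And A B) (at level 40, left associativity) : mbcl_scope.
Notation "A ∨ B" := (Or A B) (at level 50, left associativity) : mbcl_scope.
Notation "A → B" := (Arr A B) (at level 60, right associativity) : mbcl_scope.
Local Open Scope mbcl_scope.

Definition Imp (A B : form) : form := ¬ A ∨ B.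
Definition Iff (A B : form) : form := (¬ A ∨ B) ∧ (¬ B ∨ A).

Notation "A ⊃ B" := (Imp A B) (at level 60, right associativity) : mbcl_scope.
Notation "A ≡ B" := (Iff A B) (at level 65, no associativity) : mbcl_scope.

Fixpoint demod (A : form) : form :=
  match A with
  | Var n => Var n
  | ¬ B => ¬ demod B
  | □ B => demod B
  | ◇ B => demod B
  | B ∧ C => demod B ∧ demod C
  | B ∨ C => demod B ∨ demod C
  | B → C => demod B → demod C
  end.

Record frame : Type := Frame {
  world : Type;
  world_inhabited : inhabited world;
  acc : world -> world -> Prop;
  rel : world -> form -> form -> Prop
}.

Record model : Type := Model {
  model_frame : frame;
  val : world model_frame -> nat -> bool
}.

Fixpoint holds (M : model) (w : world (model_frame M)) (A : form) : Prop :=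
  match A with
  | Var n => val M w n = true
  | ¬ B => ~ holds M w B
  | □ B => forall u, acc (model_frame M) w u -> holds M u B
  | ◇ B => exists u, acc (model_frame M) w u /\ holds M u B
  | B ∧ C => holds M w B /\ holds M w C
  | B ∨ C => holds M w B \/ holds M w C
  | B → C => (~ holds M w B \/ holds M w C) /\ rel (model_frame M) w B C
  end.

Definition cond_a1 (R : form -> form -> Prop) : Prop :=
  forall A, ~ R A (¬ A).
Definition cond_a2 (R : form -> form -> Prop) : Prop :=
  forall A, ~ R (¬ A) A.
Definition cond_b0 (R : form -> form -> Prop) : Prop :=
  forall A B, R A B -> ~ R A (¬ B).
Definition cond_b1 (R : form -> form -> Prop) : Prop :=
  forall A B, R (A → B) (¬ (A → ¬ B)).
Definition cond_b2 (R : form -> form -> Prop) : Prop :=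
  forall A B, R (A → ¬ B) (¬ (A → B)).
Definition cond_demL (R : form -> form -> Prop) : Prop :=
  forall A B, R (demod A) (demod B) -> R A B.

Definition frame_class := frame -> Prop.

Definition F_dL : frame_class := fun F =>
  forall w : world F,
    cond_a1 (rel F w) /\ cond_a2 (rel F w) /\ cond_b0 (rel F w) /\
    cond_b1 (rel F w) /\ cond_b2 (rel F w) /\ cond_demL (rel F w).

Definition entails (K : frame_class) (Gamma : form -> Prop) (A : form) : Prop :=
  forall M : model, K (model_frame M) ->
  forall w : world (model_frame M),
    (forall B, Gamma B -> holds M w B) -> holds M w A.

(* Classical propositional formulas over the Boolean connectives only: the
   arrow of the modal language is not truth-functional, so it can only enter a
   CPL axiom through the substitution. *)
Inductive cform : Type :=
| CVar (n : nat)
| CNeg (a : cform)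
| CAnd (a b : cform)
| COr  (a b : cform).

Fixpoint ceval (e : nat -> bool) (a : cform) : bool :=
  match a with
  | CVar n => e n
  | CNeg b => negb (ceval e b)
  | CAnd b c => andb (ceval e b) (ceval e c)
  | COr b c => orb (ceval e b) (ceval e c)
  end.

Definition tautology (a : cform) : Prop := forall e, ceval e a = true.

Fixpoint csubst (s : nat -> form) (a : cform) : form :=
  match a with
  | CVar n => s n
  | CNeg b => ¬ csubst s b
  | CAnd b c => csubst s b ∧ csubst s c
  | COr b c => csubst s b ∨ csubst s c
  end.

Inductive axiom_CUDL : form -> Prop :=
| ax_CPL a s : tautology a -> axiom_CUDL (csubst s a)
| ax_A1 A : axiom_CUDL (¬ (A → ¬ A))
| ax_A2 A : axiom_CUDL (¬ (¬ A → A))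
| ax_B1 A B : axiom_CUDL ((A → B) → ¬ (A → ¬ B))
| ax_B2 A B : axiom_CUDL ((A → ¬ B) → ¬ (A → B))
| ax_Imp A B : axiom_CUDL ((A → B) ⊃ (A ⊃ B))
| ax_Dual A : axiom_CUDL (◇ A ≡ ¬ □ ¬ A)
| ax_K A B : axiom_CUDL (□ (A ⊃ B) ⊃ (□ A ⊃ □ B))
| ax_CUDL A B :
    axiom_CUDL ((demod A → demod B) ⊃ ((A → B) ∨ (A ∧ ¬ B))).

Inductive theorem_CUDL : form -> Prop :=
| thm_ax A : axiom_CUDL A -> theorem_CUDL A
| thm_MP A B : theorem_CUDL A -> theorem_CUDL (A ⊃ B) -> theorem_CUDL B
| thm_Nec A : theorem_CUDL A -> theorem_CUDL (□ A).

Inductive derives_CUDL (Gamma : form -> Prop) : form -> Prop :=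
| der_thm A : theorem_CUDL A -> derives_CUDL Gamma A
| der_hyp A : Gamma A -> derives_CUDL Gamma A
| der_MP A B :
    derives_CUDL Gamma A -> derives_CUDL Gamma (A ⊃ B) -> derives_CUDL Gamma B.

(* Main.v *)
From Stdlib Require Import Classical ClassicalEpsilon.
Require Import Defs.
Local Open Scope mbcl_scope.

(** Soundness by induction on derivations. Each arrow axiom beyond the classical ones matches
    conditions on [rel] at one world, while the Boolean and modal axioms hold in every Kripke model
    ([axiom_CUDL_sound]). Theorems are thus true at all worlds ([theorem_CUDL_sound]); derivations
    from [Gamma] add only detachment, which preserves truth at a fixed world. *)

Lemma holds_Imp (M : model) (w : world (model_frame M)) (A B : form) :
  holds M w (A ⊃ B) <-> (holds M w A -> holds M w B).
Proof. simpl; tauto. Qed.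

Lemma holds_csubst (M : model) (w : world (model_frame M))
    (s : nat -> form) (e : nat -> bool) (a : cform) :
  (forall n, holds M w (s n) <-> e n = true) ->
  holds M w (csubst s a) <-> ceval e a = true.
Proof.
  intros He; induction a as [n | a IHa | a IHa b IHb | a IHa b IHb]; simpl.
  - apply He.
  - rewrite IHa; destruct (ceval e a); simpl; intuition discriminate.
  - rewrite IHa, IHb; destruct (ceval e a), (ceval e b); simpl;
      intuition discriminate.
  - rewrite IHa, IHb; destruct (ceval e a), (ceval e b); simpl;
      intuition discriminate.
Qed.

Lemma tautology_holds (M : model) (w : world (model_frame M))
    (s : nat -> form) (a : cform) :
  tautology a -> holds M w (csubst s a).
Proof.
  intros Ha.
  (* Truth is a [Prop] but tautologies range over Boolean valuations, so truth at [w] is decided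
     classically. *)
  pose (e n := if excluded_middle_informative (holds M w (s n))
               then true else false).
  apply (holds_csubst M w s e); [| apply Ha].
  intros n; unfold e.
  destruct (excluded_middle_informative (holds M w (s n)));
    intuition discriminate.
Qed.

Lemma axiom_CUDL_sound (M : model) (A : form) :
  F_dL (model_frame M) -> axiom_CUDL A ->
  forall w : world (model_frame M), holds M w A.
Proof.
  intros HF HA w.
  destruct (HF w) as (a1 & a2 & b0 & b1 & b2 & demL).
  destruct HA as [a s Ha | A | A | A B | A B | A B | A | A B | A B].
  - now apply tautology_holds.
  - intros [_ HR]; exact (a1 A HR).
  - intros [_ HR]; exact (a2 A HR).
  - split; [| apply b1].
    (* (b1) relates the two sides; the material half holds because (b0) forbids relating [A] to both
       [B] and [¬ B]. *)
    apply imply_to_or; intros [_ HR] [_ HR']; exact (b0 A B HR HR').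
  - split; [| apply b2].
    apply imply_to_or; intros [_ HR] [_ HR']; exact (b0 A B HR' HR).
  - apply holds_Imp; intros [HAB _]; exact HAB.
  - split; apply holds_Imp.
    + intros [u [Hu HuA]] Hn; exact (Hn u Hu HuA).
    + intros Hn; apply NNPP; intros Hd; apply Hn.
      intros u Hu HuA; apply Hd; now exists u.
  - rewrite !holds_Imp; intros HAB HA u Hu.
    exact (proj1 (holds_Imp M u A B) (HAB u Hu) (HA u Hu)).
  (* Only the relational half of the premise is used: once [rel] links [A] to [B], the arrow can
     fail only if [A] is true and [B] false. *)
  - apply holds_Imp; intros [_ HR]; apply demL in HR; simpl; tauto.
Qed.

(** The world stays quantified in the induction, since necessitation needs truth at every
    successor. *)
Lemma theorem_CUDL_sound (M : model) (A : form) :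
  F_dL (model_frame M) -> theorem_CUDL A ->
  forall w : world (model_frame M), holds M w A.
Proof.
  intros HF HA; induction HA as [A HA | A B _ IHA _ IHAB | A _ IHA]; intros w.
  - now apply axiom_CUDL_sound.
  - exact (proj1 (holds_Imp M w A B) (IHAB w) (IHA w)).
  - intros u _; apply IHA.
Qed.

Theorem mainTheorem10 (Gamma : form -> Prop) (A : form) :
  derives_CUDL Gamma A -> entails F_dL Gamma A.
Proof.
  intros HA M HF w HGamma.
  induction HA as [A HA | A HA | A B _ IHA _ IHAB].
  - now apply theorem_CUDL_sound.
  - now apply HGamma.
  - exact (proj1 (holds_Imp M w A B) IHAB IHA).
Qed.
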